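(* There is an absolute constant $c>0$ such that the following holds. Let $\xi=(\xi_1,\dots,\xi_n)\in\mathbb{R}^n$ be a centered isotropic random vector and $h:[1,\infty)\to(0,\infty]$ a function such that for all $v\in\mathbb{R}^n$ and all $p\ge1$, $$\left(\mathbb{E}\left(|\langle\xi,v\rangle|^p\right)\right)^{1/p}\le h(p)\left(\mathbb{E}\left(|g|^p\right)\right)^{1/p}\|v\|_2,$$ where $g\sim\mathrm{Normal}(0,1)$. Given deterministic matrices $A_1,\dots,A_n\in\mathbb{R}^{d_1\times d_2}$, let $X=\sum_{i=1}^n\xi_iA_i$. Then for any $t\ge0$, with probability at least $1-e^{-t}$, $$\|X\|_{\mathrm{op}}\le c\,\inf_{p\ge2}\ e^{t/p}\,h(p)\left(\sigma_*\,p^{1/2}+\sigma+\upsilon+\sigma_\diamond\,p^{-1/2}\right),$$ where $$\sigma_*=\sup_{w\in\mathbb{R}^n:\|w\|_2\le1}\left\|\sum_{i=1}^nw_iA_i\right\|_{\mathrm{op}},\qquad \upsilon=\sup_{w\in\mathbb{R}^n:\|w\|_2\le1}\left\|\sum_{i=1}^nw_iA_i\right\|_{\mathrm{F}},$$ $$\sigma=\left\|\sum_{i=1}^nA_i^\top A_i\right\|_{\mathrm{op}}^{1/2}+\left\|\sum_{i=1}^nA_iA_i^\top\right\|_{\mathrm{op}}^{1/2},\qquad \sigma_\diamond=\left(\sum_{i=1}^n\|A_i\|_{\mathrm{F}}^2\right)^{1/2}.$$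
   Context: Isotropic means $\mathbb{E}(\xi\xi^\top)=I$. The coordinates of $\xi$ are not assumed independent. $\|\cdot\|_{\mathrm{op}}$ is the operator (spectral) norm and $\|\cdot\|_{\mathrm{F}}$ the Frobenius norm. *)

(* Defs.v *)
From mathcomp Require Export all_boot all_order all_algebra.
From mathcomp Require Export all_classical all_reals all_analysis.
Set Implicit Arguments.
Unset Strict Implicit.
Unset Printing Implicit Defensive.
Export Order.TTheory GRing.Theory Num.Theory.
Export numFieldNormedType.Exports.

Local Open Scope classical_set_scope.
Local Open Scope ring_scope.

(* The library's norm `|A| on 'M[R]_(m, n) is the entrywise maximum, so the
   Euclidean, operator and Frobenius norms are defined separately. *)
Definition l2_norm (R : realType) (n : nat) (x : 'cV[R]_n) : R :=
  Num.sqrt (\sum_i x i 0 ^+ 2).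

Definition frob_norm (R : realType) (m n : nat) (A : 'M[R]_(m, n)) : R :=
  Num.sqrt (\sum_i \sum_j A i j ^+ 2).

Definition l2_ball (R : realType) (n : nat) : set 'cV[R]_n :=
  [set x | l2_norm x <= 1].

(* All real suprema below range over nonempty sets (the ball contains 0) that
   are bounded above (continuous functions on the unit ball of R^n). *)
Definition op_norm (R : realType) (m n : nat) (A : 'M[R]_(m, n)) : R :=
  sup [set l2_norm (A *m x) | x in @l2_ball R n].

Definition lin_comb (R : realType) (n d1 d2 : nat)
    (A : 'I_n -> 'M[R]_(d1, d2)) (w : 'cV[R]_n) : 'M[R]_(d1, d2) :=
  \sum_i w i 0 *: A i.

Definition sigma_star (R : realType) (n d1 d2 : nat)
    (A : 'I_n -> 'M[R]_(d1, d2)) : R :=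
  sup [set op_norm (lin_comb A w) | w in @l2_ball R n].

Definition upsilon (R : realType) (n d1 d2 : nat)
    (A : 'I_n -> 'M[R]_(d1, d2)) : R :=
  sup [set frob_norm (lin_comb A w) | w in @l2_ball R n].

Definition sigma (R : realType) (n d1 d2 : nat)
    (A : 'I_n -> 'M[R]_(d1, d2)) : R :=
  Num.sqrt (op_norm (\sum_i (A i)^T *m A i)) +
  Num.sqrt (op_norm (\sum_i A i *m (A i)^T)).

Definition sigma_diamond (R : realType) (n d1 d2 : nat)
    (A : 'I_n -> 'M[R]_(d1, d2)) : R :=
  Num.sqrt (\sum_i frob_norm (A i) ^+ 2).

(* A random vector in R^n is given by its n real random variables on a common
   probability space. *)
Definition random_vector (R : realType) (d : measure_display)
    (T : measurableType d) (P : probability T R) (n : nat) : Type :=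
  'I_n -> {RV P >-> R}.

Definition rv_value (R : realType) (d : measure_display)
    (T : measurableType d) (P : probability T R) (n : nat)
    (xi : random_vector P n) (omega : T) : 'cV[R]_n :=
  \col_i xi i omega.

Definition inner (R : realType) (n : nat) (x y : 'cV[R]_n) : R :=
  \sum_i x i 0 * y i 0.

Definition centered (R : realType) (d : measure_display)
    (T : measurableType d) (P : probability T R) (n : nat)
    (xi : random_vector P n) : Prop :=
  forall i, ('E_P[xi i] = 0)%E.

Definition isotropic (R : realType) (d : measure_display)
    (T : measurableType d) (P : probability T R) (n : nat)
    (xi : random_vector P n) : Prop :=
  forall i j, ('E_P[fun omega => (xi i omega * xi j omega)%R]
               = ((1%:M : 'M[R]_n) i j)%:E)%E.

(* (E |g|^p)^(1/p) for g ~ Normal(0, 1) *)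
Definition gauss_Lp (R : realType) (p : R) : \bar R :=
  Lnorm (normal_prob (0 : R) 1) p%:E EFin.

Definition moment_bound (R : realType) (d : measure_display)
    (T : measurableType d) (P : probability T R) (n : nat)
    (xi : random_vector P n) (h : R -> \bar R) : Prop :=
  forall (v : 'cV[R]_n) (p : R), 1 <= p ->
    (Lnorm P p%:E (fun omega => (inner (rv_value xi omega) v)%:E)
     <= h p * gauss_Lp p * (l2_norm v)%:E)%E.

(* Main.v *)
(* Smooth the bilinear form [u^T X v]: replace [u] and [v] by independent random
   vectors [U] and [V] with means [u] and [v] and covariances at most [I / p],
   whose joint law [rho_(u,v)] has a density [r] with respect to a fixed law
   [mu], where [r] has second moment at most [exp (2 p)].
   Let [T(U, V)] be the vector [(U^T A_i V)_i], so that [U^T X V = <xi, T(U, V)>].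
   Its second moment under [rho_(u,v)] is at most
   [sigma_star^2 + sigma^2 / p + sigma_diamond^2 / p^2], so [|T(U, V)|_2 <= K]
   with high probability, for [K] a multiple of the square root of this bound.
   By a Paley-Zygmund argument [|U^T X V| >= |u^T X v| / 4] with probability
   bounded below.  Hence [|u^T X v|] is at most a constant times the
   [rho_(u,v)]-mean of [1_(|T| <= K) |<xi, T>|], and a change of measure bounds
   this mean through the [p]-th moment of [1_(|T| <= K) |<xi, T>|] under [mu],
   which depends neither on [u] nor on [v].  Its expectation over [xi] is
   controlled by the moment hypothesis, and Markov's inequality concludes.
   The laws are those of rescaled sums of random signs, biased for
   [rho_(u,v)] and fair for [mu], so that all averages over [(U, V)] are finite
   sums. *)
Require Import Defs.
From mathcomp Require Import measurable_realfun ring lra.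

Set Implicit Arguments.
Unset Strict Implicit.
Unset Printing Implicit Defensive.

Local Open Scope classical_set_scope.
Local Open Scope ring_scope.

(** * Biased random signs *)

Section biased_signs.
Variables (R : realType) (J : finType).
Implicit Types (th b : J -> R) (e : {ffun J -> bool}) (f : {ffun J -> bool} -> R).

(** The probability of the sign [(-1) ^+ s] under the law of mean [x]; [true] encodes the sign
    -1. *)
Definition coin (x : R) (s : bool) : R := (1 + x * (-1) ^+ s) / 2.

Definition coins th e : R := \prod_j coin (th j) (e j).

(* The expectation of [f] under independent signs [(-1) ^+ e j] of means [th j]. *)
Definition esign th f : R := \sum_e coins th e * f e.

Lemma coin_ge0 x s : `|x| <= 1 -> 0 <= coin x s.
Proof.
by rewrite ler_norml /coin => /andP[x1 x2]; case: s; rewrite ?expr0 ?expr1; lra.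
Qed.

Lemma coins_ge0 th e : (forall j, `|th j| <= 1) -> 0 <= coins th e.
Proof. by move=> th1; apply: prodr_ge0 => j _; exact: coin_ge0. Qed.

Lemma coins_prod (F : J -> bool -> R) :
  \sum_(e : {ffun J -> bool}) \prod_j F j (e j) = \prod_j (F j true + F j false).
Proof.
rewrite -(bigA_distr_bigA F).
by apply: eq_bigr => j _; rewrite big_bool.
Qed.

Lemma esign1 th : \sum_e coins th e = 1.
Proof.
rewrite (coins_prod (fun j => coin (th j))); apply: big1 => j _.
by rewrite /coin expr0 expr1; lra.
Qed.

Lemma esignD th f g : esign th (fun e => f e + g e) = esign th f + esign th g.
Proof. by rewrite -big_split; apply: eq_bigr => e _; rewrite mulrDr. Qed.

Lemma esignZ th c f : esign th (fun e => c * f e) = c * esign th f.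
Proof. by rewrite /esign mulr_sumr; apply: eq_bigr => e _; rewrite mulrCA. Qed.

Lemma esign_cst th c : esign th (fun=> c) = c.
Proof. by rewrite /esign -mulr_suml esign1 mul1r. Qed.

Lemma ler_esign th f g : (forall j, `|th j| <= 1) -> (forall e, f e <= g e) ->
  esign th f <= esign th g.
Proof. by move=> th1 fg; apply: ler_sum => e _; rewrite ler_wpM2l ?coins_ge0. Qed.

(** The likelihood ratio of the biased signs against the fair ones. *)
Definition sign_density th e : R := \prod_j (1 + th j * (-1) ^+ e j).

Lemma coins_density th e : coins th e = coins (fun=> 0) e * sign_density th e.
Proof.
rewrite /coins /sign_density -big_split; apply: eq_bigr => j _ /=.
by rewrite /coin; lra.
Qed.

Lemma sign_density_ge0 th e : (forall j, `|th j| <= 1) -> 0 <= sign_density th e.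
Proof.
move=> th1; apply: prodr_ge0 => j _.
by have := coin_ge0 (e j) (th1 j); rewrite /coin; lra.
Qed.

(** By independence the second moment factors over [J]; each factor is [1 + th j ^+ 2], at most
    [expR (th j ^+ 2)]. *)
Lemma sign_density_sqr th :
  esign (fun=> 0) (fun e => sign_density th e ^+ 2) <= expR (\sum_j th j ^+ 2).
Proof.
rewrite expR_sum.
have -> : esign (fun=> 0) (fun e => sign_density th e ^+ 2) =
    \sum_(e : {ffun J -> bool}) \prod_j (coin 0 (e j) * (1 + th j * (-1) ^+ e j) ^+ 2).
  apply: eq_bigr => e _.
  by rewrite /coins /sign_density -prodrXl -big_split.
rewrite (coins_prod (fun j s => coin 0 s * (1 + th j * (-1) ^+ s) ^+ 2)).
apply: ler_prod => j _; apply/andP; split.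
  by rewrite /coin expr0 expr1; nra.
apply: le_trans (expR_ge1Dx _).
by rewrite /coin expr0 expr1; lra.
Qed.

Definition flip (j : J) e : {ffun J -> bool} :=
  [ffun k => if k == j then ~~ e k else e k].

Lemma flipK j : involutive (flip j).
Proof.
by move=> e; apply/ffunP => k; rewrite !ffunE; case: eqP => //; rewrite negbK.
Qed.

(** [flip j] matches the configurations with [e j] true and those with [e j] false, so both halves
    carry the same sum of [rest]. Taking [g] constant identifies this half-sum with [esign th f]. *)
Lemma esign_indep th j (g : bool -> R) f : (forall e, f (flip j e) = f e) ->
  esign th (fun e => g (e j) * f e) =
  (coin (th j) true * g true + coin (th j) false * g false) * esign th f.
Proof.
move=> fj.
pose rest e := (\prod_(k | k != j) coin (th k) (e k)) * f e.
have restj e : rest (flip j e) = rest e.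
  rewrite /rest fj; congr (_ * _).
  by apply: eq_bigr => k /negPf kj; rewrite ffunE kj.
have key (g' : bool -> R) : esign th (fun e => g' (e j) * f e) =
    (coin (th j) true * g' true + coin (th j) false * g' false) *
    \sum_(e : {ffun J -> bool} | e j) rest e.
  have E e : coins th e * (g' (e j) * f e) = coin (th j) (e j) * g' (e j) * rest e.
    by rewrite /coins (bigD1 j) //= /rest; ring.
  rewrite /esign (bigID (fun e : {ffun J -> bool} => e j)) /=.
  rewrite (_ : \sum_(e : {ffun J -> bool} | ~~ e j) _ =
      coin (th j) false * g' false * \sum_(e : {ffun J -> bool} | e j) rest e).
    rewrite mulrDl; congr (_ + _); rewrite mulr_sumr.
    by apply: eq_bigr => e ej; rewrite E ej.
  rewrite mulr_sumr (reindex_inj (inv_inj (flipK j))) /=.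
  apply: eq_big => [e|e]; rewrite ffunE eqxx ?negbK // => ej.
  by have := E (flip j e); rewrite ffunE eqxx ej restj.
rewrite key; congr (_ * _).
have := key (fun=> 1); rewrite /esign.
under eq_bigr do rewrite mul1r.
by move=> ->; rewrite !mulr1 [X in X * _](_ : _ = 1) ?mul1r // /coin expr0 expr1; lra.
Qed.

(** The increments are centered, so the mean is [a]. The sum runs over a list so that induction can
    add one sign at a time. *)
Definition sign_form th b (a : R) (s : seq J) e : R :=
  a + \sum_(j <- s) b j * ((-1) ^+ e j - th j).

(** Induction on [s]: the new increment is independent of the form [L] built so far, so the powers
    expand binomially into products of moments. Biases of modulus at most 1/2 keep each variance
    above 3/4, which lets the squared variances dominate the fourth-order terms. *)
Lemma sign_form_moments th b (a : R) (s : seq J) :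
  (forall j, `|th j| <= 2^-1) -> uniq s ->
  [/\ esign th (sign_form th b a s) = a,
      esign th (fun e => sign_form th b a s e ^+ 2) =
        a ^+ 2 + \sum_(j <- s) b j ^+ 2 * (1 - th j ^+ 2) &
      esign th (fun e => sign_form th b a s e ^+ 4) <=
        11 * (esign th (fun e => sign_form th b a s e ^+ 2)) ^+ 2].
Proof.
move=> th2; elim: s => [_|j s IHs /= /andP[js us]].
  rewrite /sign_form; split.
  - under [LHS]eq_bigr do rewrite big_nil addr0.
    exact: esign_cst.
  - under [LHS]eq_bigr do rewrite big_nil addr0.
    by rewrite big_nil addr0; exact: esign_cst.
  - rewrite /esign; under eq_bigr do rewrite big_nil addr0.
    under [X in _ <= _ * X ^+ 2]eq_bigr do rewrite big_nil addr0.
    rewrite -!/(esign _ (fun=> _)) !esign_cst -exprM.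
    have : 0 <= a ^+ 4 by rewrite exprn_even_ge0.
    by move=> ?; lra.
have [m1 m2 m4] := IHs us.
set L := sign_form th b a s in m1 m2 m4.
set x := th j; have x2 : `|x| <= 2^-1 := th2 j.
pose h (t : bool) : R := (-1) ^+ t - x.
have LE e : sign_form th b a (j :: s) e = L e + b j * h (e j).
  rewrite /L /sign_form big_cons /h -/x.
  by move: ((-1) ^+ e j) (\sum_(_ <- s) _) => u w; ring.
have Lj e : L (flip j e) = L e.
  rewrite /L /sign_form; congr (_ + _); apply: eq_big_seq => k ks.
  by rewrite ffunE; case: eqP => // kj; rewrite -kj ks in js.
clearbody L.
have ind m k : esign th (fun e => h (e j) ^+ m * L e ^+ k) =
   (coin x true * h true ^+ m + coin x false * h false ^+ m) *
   esign th (fun e => L e ^+ k).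
  by apply: (esign_indep _ (fun t => h t ^+ m)) => e; rewrite Lj.
have hE1 : h true = - 1 - x by [].
have hE2 : h false = 1 - x by [].
have cE1 : coin x true = (1 - x) / 2 by rewrite /coin expr1; lra.
have cE2 : coin x false = (1 + x) / 2 by rewrite /coin expr0; lra.
have m0 : esign th (fun e => L e ^+ 0) = 1.
  by under [LHS]eq_bigr do rewrite expr0; exact: esign_cst.
have m1' : esign th (fun e => L e ^+ 1) = a.
  by under [LHS]eq_bigr do rewrite expr1.
have M2 : esign th (fun e => sign_form th b a (j :: s) e ^+ 2) =
    esign th (fun e => L e ^+ 2) + b j ^+ 2 * (1 - x ^+ 2).
  transitivity (esign th (fun e => L e ^+ 2 +
     (2 * b j * (h (e j) ^+ 1 * L e ^+ 1) + b j ^+ 2 * (h (e j) ^+ 2 * L e ^+ 0)))).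
    by apply: eq_bigr => e _; rewrite LE; congr (_ * _); ring.
  rewrite !(esignD, esignZ) !ind m1' m0 hE1 hE2 cE1 cE2.
  by field.
split.
- transitivity (esign th (fun e => L e + b j * (h (e j) ^+ 1 * L e ^+ 0))).
    by apply: eq_bigr => e _; rewrite LE; congr (_ * _); ring.
  rewrite !(esignD, esignZ) !ind m1 m0 hE1 hE2 cE1 cE2.
  by field.
- by rewrite M2 m2 big_cons -/x -addrA [X in _ + X]addrC.
- rewrite M2.
  have -> : esign th (fun e => sign_form th b a (j :: s) e ^+ 4) =
    esign th (fun e => L e ^+ 4 +
     (4 * b j * (h (e j) ^+ 1 * L e ^+ 3) + (6 * b j ^+ 2 * (h (e j) ^+ 2 * L e ^+ 2)
     + (4 * b j ^+ 3 * (h (e j) ^+ 3 * L e ^+ 1) + b j ^+ 4 * (h (e j) ^+ 4 * L e ^+ 0))))).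
    by apply: eq_bigr => e _; rewrite LE; congr (_ * _); ring.
  rewrite !(esignD, esignZ) !ind m1' m0 hE1 hE2 cE1 cE2.
  move: m2 m4; set M := esign th (fun e => L e ^+ 2); set M4 := esign th _ => m2 m4.
  have aM : a ^+ 2 <= M.
    rewrite m2 lerDl; apply: sumr_ge0 => k _; rewrite mulr_ge0 ?sqr_ge0 //.
    by have := th2 k; rewrite ler_norml => /andP[? ?]; nra.
  move: x2; rewrite ler_norml => /andP[x1 x2].
  have x3 : x ^+ 2 <= 4^-1 by nra.
  have x0 := sqr_ge0 x.
  set v := 1 - x ^+ 2; set y := b j.
  have v34 : 3 / 4 <= v by rewrite /v; lra.
  have -> : M4 + (4 * y * (((1 - x) / 2 * (-1 - x) ^+ 1 + (1 + x) / 2 * (1 - x) ^+ 1) *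
      esign th (fun e => L e ^+ 3)) +
    (6 * y ^+ 2 * (((1 - x) / 2 * (-1 - x) ^+ 2 + (1 + x) / 2 * (1 - x) ^+ 2) * M) +
     (4 * y ^+ 3 * (((1 - x) / 2 * (-1 - x) ^+ 3 + (1 + x) / 2 * (1 - x) ^+ 3) * a) +
      y ^+ 4 * (((1 - x) / 2 * (-1 - x) ^+ 4 + (1 + x) / 2 * (1 - x) ^+ 4) * 1)))) =
    M4 + 6 * y ^+ 2 * v * M + 4 * y ^+ 3 * (-2 * x * v) * a
      + y ^+ 4 * (v * (1 + 3 * x ^+ 2)).
    by rewrite /v; field.
  (* The bias makes the third central moment nonzero. The cross term is absorbed by [-4 * x * y * a
     <= y ^+ 2 + 4 * x ^+ 2 * a ^+ 2], together with [4 * x ^+ 2 <= 1] and [a ^+ 2 <= M]. *)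
  have c3 : 4 * y ^+ 3 * (-2 * x * v) * a <= 2 * v * y ^+ 2 * (y ^+ 2 + M).
    have -> : 4 * y ^+ 3 * (-2 * x * v) * a = 2 * v * y ^+ 2 * (-4 * x * y * a) by ring.
    apply: ler_wpM2l; first by rewrite mulr_ge0 ?sqr_ge0 //; lra.
    have : 0 <= (y + 2 * x * a) ^+ 2 by exact: sqr_ge0.
    have : 4 * x ^+ 2 * a ^+ 2 <= a ^+ 2.
      by have := sqr_ge0 a; nra.
    by move=> ? ?; nra.
  have c4 : y ^+ 4 * (v * (1 + 3 * x ^+ 2)) <= 2 * v * y ^+ 4.
    have : 0 <= y ^+ 4 by rewrite exprn_even_ge0.
    move=> y4; rewrite (_ : 2 * v * y ^+ 4 = y ^+ 4 * (v * 2)); last by ring.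
    apply: ler_wpM2l => //; apply: ler_wpM2l; lra.
  (* [4 <= 11 * v] because [v] is at least 3/4. *)
  have c5 : 4 * v * y ^+ 4 <= 11 * y ^+ 4 * v ^+ 2.
    have : 0 <= y ^+ 4 by rewrite exprn_even_ge0.
    have : 4 * v <= 11 * v ^+ 2 by nra.
    by move=> ? ?; nra.
  have M0 : 0 <= M by apply: le_trans aM; exact: sqr_ge0.
  have c6 : 0 <= v * y ^+ 2 * M.
    by apply: mulr_ge0 => //; apply: mulr_ge0; rewrite ?sqr_ge0 //; lra.
  have -> : 11 * (M + y ^+ 2 * v) ^+ 2 =
    11 * M ^+ 2 + 22 * (v * y ^+ 2 * M) + 11 * y ^+ 4 * v ^+ 2 by ring.
  have e2 : 2 * v * y ^+ 2 * (y ^+ 2 + M) = 2 * v * y ^+ 4 + 2 * (v * y ^+ 2 * M) by ring.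
  have e6 : 6 * y ^+ 2 * v * M = 6 * (v * y ^+ 2 * M) by ring.
  by rewrite e6; rewrite e2 in c3; lra.
Qed.

(** Since [a ^+ 2] is at most the second moment [M], the event contains [L ^+ 2 >= M / 4]. The
    indicator is bounded below by a quadratic polynomial in [L ^+ 2], whose mean the second and
    fourth moments control. *)
Lemma sign_form_paley_zygmund th b (a : R) (s : seq J) :
  (forall j, `|th j| <= 2^-1) -> uniq s ->
  20^-1 <= esign th (fun e => (`|a| / 2 <= `|sign_form th b a s e|)%R%:R).
Proof.
move=> th2 us.
have th1 j : `|th j| <= 1 by apply: le_trans (th2 j) _; lra.
have [_ m2 m4] := sign_form_moments b a th2 us.
set L := sign_form th b a s in m2 m4 *.
set M := esign th (fun e => L e ^+ 2) in m2 m4.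
have aM : a ^+ 2 <= M.
  rewrite m2 lerDl; apply: sumr_ge0 => k _; rewrite mulr_ge0 ?sqr_ge0 //.
  by have := th2 k; rewrite ler_norml => /andP[? ?]; nra.
(* If the second moment vanishes then so does [a], and the event is certain. *)
have [M0|M0] := leP M 0.
  have a0 : a = 0.
    by apply/eqP; rewrite -sqrf_eq0 eq_le sqr_ge0 (le_trans aM).
  rewrite a0 normr0 mul0r (_ : (fun e => _) = fun=> 1) ?esign_cst; first by lra.
  by apply/funext => e; rewrite normr_ge0.
(* With [s = L^2 / M], the indicator of [s >= 1/4] dominates
   [2 x s - x^2 s^2 - x / 2], used at [x = 1/16]. *)
pose q e := 8^-1 * M^-1 * L e ^+ 2 + ((- 256^-1 * M^-1 ^+ 2) * L e ^+ 4 + - 32^-1).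
have qle e : q e <= (`|a| / 2 <= `|L e|)%R%:R.
  have -> : q e = 8^-1 * (L e ^+ 2 / M) - 256^-1 * (L e ^+ 2 / M) ^+ 2 - 32^-1.
    by rewrite /q; field; rewrite gt_eqF.
  have s0 : 0 <= L e ^+ 2 / M by rewrite divr_ge0 ?sqr_ge0 // ltW.
  case: (leP (`|a| / 2) `|L e|) => [_|aL] /=.
    by have := sqr_ge0 (1 - 16^-1 * (L e ^+ 2 / M)); lra.
  have : L e ^+ 2 / M <= 4^-1.
    rewrite ler_pdivrMr // -real_normK ?num_real //.
    have := normr_ge0 (L e); have : `|a| ^+ 2 <= M by rewrite real_normK ?num_real.
    have := normr_ge0 a; move: aL; move: `|L e| `|a| => u w ? ? ? ?.
    have : 0 <= (w / 2 - u) * (w / 2 + u) by apply: mulr_ge0; lra.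
    by move=> ?; nra.
  by move: s0; set z := L e ^+ 2 / M => ? ?; nra.
apply: le_trans (ler_esign th1 qle).
rewrite /q !(esignD, esignZ) esign_cst.
have -> : esign th (fun e => L e ^+ 2) = M by [].
have : M^-1 ^+ 2 * esign th (fun e => L e ^+ 4) <= 11.
  by rewrite exprVn mulrC ler_pdivrMr ?exprn_gt0.
rewrite -[8^-1 * _ * _]mulrA mulVf ?gt_eqF // mulr1.
set z := esign th (fun e => L e ^+ 4).
have -> : - 256^-1 * M^-1 ^+ 2 * z = - 256^-1 * (M^-1 ^+ 2 * z) by ring.
(* The mean of [q] is at least 1/8 - 11/256 - 1/32 = 13/256, slightly above 1/20. *)
by move: (M^-1 ^+ 2 * z) => w ?; lra.
Qed.

End biased_signs.

(** * Smoothing by random signs *)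

Lemma l2_norm_sqr (R : realType) n (x : 'cV[R]_n) : l2_norm x ^+ 2 = inner x x.
Proof.
rewrite sqr_sqrtr; last by apply: sumr_ge0 => i _; exact: sqr_ge0.
by apply: eq_bigr => i _; rewrite expr2.
Qed.

Lemma l2_norm_ge0 (R : realType) n (x : 'cV[R]_n) : 0 <= l2_norm x.
Proof. exact: sqrtr_ge0. Qed.

(* The randomization replaces [u] by a normalized sum of [N] random signs per
   coordinate, so that the density of the law centered at [u] with respect to
   the law centered at [0] has second moment at most [exp p] whatever [d] is. *)
Lemma sign_smoothing (R : realType) (d : nat) (p : R) : 0 < p ->
  exists (Om : finType) (mu : Om -> R) (W : Om -> 'cV[R]_d),
  [/\ forall o, 0 <= mu o, \sum_o mu o = 1 &
   forall u, l2_norm u <= 1 -> exists r : Om -> R,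
    [/\ forall o, 0 <= r o, \sum_o mu o * r o = 1,
      \sum_o mu o * r o ^+ 2 <= expR p,
      forall y, \sum_o mu o * r o * inner y (W o) ^+ 2
        <= inner y u ^+ 2 + inner y y / p &
      forall y, 20^-1 <= \sum_o mu o * r o *
        (`|inner y u| / 2 <= `|inner y (W o)|)%R%:R ]].
Proof.
move=> p0; have p40 : 0 <= 4 * p by lra.
(* [N > 4 p] forces [th j ^+ 2 <= p / N <= 1/4], as the moment bounds for signs require. *)
pose N := Num.bound (4 * p).
have pN : 4 * p < N%:R := archi_boundP p40.
have N0 : 0 < N%:R :> R by apply: le_lt_trans pN.
(* Each coordinate of [W] then has variance at most [alpha ^+ 2 * N%:R], which is [1 / p]. *)
pose alpha : R := (Num.sqrt (p * N%:R))^-1.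
have alpha0 : 0 < alpha by rewrite invr_gt0 sqrtr_gt0 mulr_gt0.
have alpha2 : alpha ^+ 2 = (p * N%:R)^-1.
  by rewrite exprVn sqr_sqrtr // mulr_ge0 // ltW.
pose J : finType := ('I_d * 'I_N)%type.
pose W (e : {ffun J -> bool}) : 'cV[R]_d :=
  \col_i (alpha * \sum_k (-1) ^+ e (i, k)).
exists {ffun J -> bool}, (coins (fun=> 0)), W; split.
- by move=> e; apply: coins_ge0 => j; rewrite normr0.
- exact: esign1.
(* This bias gives coordinate [i] of [W] the mean [u i 0]. The squared biases sum to
   [p * inner u u <= p], whence the bound [expR p]. *)
move=> u u1; pose th (j : J) := u j.1 0 / (N%:R * alpha).
have u2 : inner u u <= 1.
  by rewrite -l2_norm_sqr; have := l2_norm_ge0 u; nra.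
have ui i : u i 0 ^+ 2 <= 1.
  apply: le_trans u2; rewrite /inner (bigD1 i) //= expr2 lerDl.
  by apply: sumr_ge0 => j _; rewrite -expr2 sqr_ge0.
have thE j : th j ^+ 2 = u j.1 0 ^+ 2 * (p / N%:R).
  rewrite /th expr_div_n exprMn alpha2; field.
  by rewrite !gt_eqF.
have th2 j : `|th j| <= 2^-1.
  rewrite -ler_sqr ?nnegrE ?normr_ge0 ?invr_ge0 // real_normK ?num_real // thE.
  have : p / N%:R <= 4^-1 by rewrite ler_pdivrMr //; lra.
  have : 0 <= p / N%:R by rewrite divr_ge0 // ltW.
  by have := ui j.1; have := sqr_ge0 (u j.1 0); nra.
have th1 j : `|th j| <= 1 by apply: le_trans (th2 j) _; lra.
have sumJ (F : 'I_d -> R) : \sum_(j : J) F j.1 = N%:R * \sum_i F i.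
  rewrite -(pair_bigA _ (fun i (k : 'I_N) => F i)) /= mulr_sumr.
  by apply: eq_bigr => i _; rewrite sumr_const card_ord mulr_natl.
have E f : \sum_e coins (fun=> 0) e * sign_density th e * f e = esign th f.
  by apply: eq_bigr => e _; rewrite -coins_density.
pose b (y : 'cV[R]_d) (j : J) := y j.1 0 * alpha.
have LE y e : inner y (W e) = sign_form th (b y) (inner y u) (index_enum J) e.
  rewrite /sign_form.
  under eq_bigr do rewrite mulrBr.
  rewrite sumrB.
  have -> : \sum_(j : J) b y j * th j = inner y u.
    rewrite (eq_bigr (fun j : J => N%:R^-1 * (y j.1 0 * u j.1 0))); last first.
      by move=> j _; rewrite /b /th; field; rewrite !gt_eqF.
    rewrite (sumJ (fun i => N%:R^-1 * (y i 0 * u i 0))) -mulr_sumr mulrA.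
    by rewrite mulfV ?gt_eqF // mul1r.
  rewrite addrC subrK (eq_bigr (fun j : J => b y (j.1, j.2) * (-1) ^+ e (j.1, j.2)));
    last by case.
  rewrite -(pair_bigA _ (fun i k => b y (i, k) * (-1) ^+ e (i, k))) /=.
  by apply: eq_bigr => i _; rewrite mxE mulrA mulr_sumr.
exists (sign_density th); split.
- by move=> e; exact: sign_density_ge0.
- by have := E (fun=> 1); rewrite esign_cst => <-; apply: eq_bigr => e _; rewrite mulr1.
- apply: le_trans (sign_density_sqr th) _; rewrite ler_expR.
  under eq_bigr do rewrite thE.
  rewrite (sumJ (fun i => u i 0 ^+ 2 * (p / N%:R))) -mulr_suml mulrCA.
  rewrite [N%:R * _]mulrC divfK ?gt_eqF //; apply: ler_piMl; first exact: ltW.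
  by apply: le_trans u2; apply: ler_sum => i _; rewrite expr2.
- move=> y; rewrite E (funext (fun e => congr1 (fun z => z ^+ 2) (LE y e))).
  have [_ -> _] := sign_form_moments (b y) (inner y u) th2 (index_enum_uniq J).
  rewrite lerD2l.
  apply: (@le_trans _ _ (\sum_(j : J) (y j.1 0 * y j.1 0) * (p * N%:R)^-1)).
    apply: ler_sum => j _; rewrite /b exprMn alpha2 -expr2; apply: ler_piMr.
      by rewrite mulr_ge0 ?sqr_ge0 // invr_ge0 mulr_ge0 // ltW.
    by rewrite gerBl sqr_ge0.
  rewrite (sumJ (fun i => (y i 0 * y i 0) * (p * N%:R)^-1)) -mulr_suml.
  rewrite le_eqVlt; apply/orP; left; apply/eqP.
  by rewrite /inner; field; rewrite !gt_eqF.
- move=> y; rewrite E.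
  rewrite (funext (fun e => congr1 (fun z => (`|inner y u| / 2 <= `|z|)%R%:R) (LE y e))).
  exact: (sign_form_paley_zygmund (b y) (inner y u) th2 (index_enum_uniq J)).
Qed.

(** * Operator norm and the matrix parameters *)

Section norms.
Variable R : realType.

Lemma innerC n (x y : 'cV[R]_n) : inner x y = inner y x.
Proof. by apply: eq_bigr => i _; rewrite mulrC. Qed.

Lemma inner_ge0 n (x : 'cV[R]_n) : 0 <= inner x x.
Proof. by rewrite -l2_norm_sqr sqr_ge0. Qed.

Lemma inner_trmx m n (A : 'M[R]_(m, n)) u v : inner (A *m v) u = inner (A^T *m u) v.
Proof.
rewrite /inner; under eq_bigr do rewrite mxE mulr_suml.
rewrite exchange_big /=; apply: eq_bigr => j _.
by rewrite mxE mulr_suml; apply: eq_bigr => i _; rewrite mxE mulrAC.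
Qed.

Lemma inner_sumr n (I : finType) x (y : I -> 'cV[R]_n) :
  inner x (\sum_i y i) = \sum_i inner x (y i).
Proof.
rewrite /inner exchange_big /=; apply: eq_bigr => j _.
by rewrite summxE mulr_sumr.
Qed.

Lemma innerZr n c (x y : 'cV[R]_n) : inner x (c *: y) = c * inner x y.
Proof. by rewrite /inner mulr_sumr; apply: eq_bigr => i _; rewrite mxE mulrCA. Qed.

Lemma cauchy_schwarz_sqr n (x y : 'cV[R]_n) :
  inner x y ^+ 2 <= inner x x * inner y y.
Proof.
have [y0|y0] := leP (inner y y) 0.
  have yi i : y i 0 = 0.
    have := y0; rewrite /inner (bigD1 i) //= => yle.
    have : 0 <= \sum_(j | j != i) y j 0 * y j 0.
      by apply: sumr_ge0 => j _; rewrite -expr2 sqr_ge0.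
    move=> s0; apply/eqP; rewrite -sqrf_eq0 eq_le sqr_ge0 andbT expr2.
    by apply: le_trans yle; rewrite lerDl.
  rewrite [inner x y]big1 => [|i _]; last by rewrite yi mulr0.
  by rewrite expr0n /= mulr_ge0 ?inner_ge0.
have : 0 <= \sum_i (inner y y * x i 0 - inner x y * y i 0) ^+ 2.
  by apply: sumr_ge0 => i _; exact: sqr_ge0.
have -> : \sum_i (inner y y * x i 0 - inner x y * y i 0) ^+ 2 =
    inner y y * (inner x x * inner y y - inner x y ^+ 2).
  have gen a b : \sum_i (a * x i 0 - b * y i 0) ^+ 2 =
      a ^+ 2 * inner x x - 2 * a * b * inner x y + b ^+ 2 * inner y y.
    rewrite /inner !mulr_sumr -sumrB -big_split /=.
    by apply: eq_bigr => i _; ring.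
  by rewrite gen; ring.
by rewrite pmulr_rge0 // subr_ge0.
Qed.

Lemma cauchy_schwarz n (x y : 'cV[R]_n) : `|inner x y| <= l2_norm x * l2_norm y.
Proof.
rewrite -ler_sqr ?nnegrE ?mulr_ge0 ?l2_norm_ge0 //.
by rewrite real_normK ?num_real // exprMn !l2_norm_sqr cauchy_schwarz_sqr.
Qed.

Lemma l2_norm0 n : l2_norm (0 : 'cV[R]_n) = 0.
Proof. by rewrite /l2_norm big1 ?sqrtr0 // => i _; rewrite mxE expr0n. Qed.

Lemma l2_normZ n c (x : 'cV[R]_n) : l2_norm (c *: x) = `|c| * l2_norm x.
Proof.
rewrite /l2_norm -sqrtr_sqr -sqrtrM ?sqr_ge0 // mulr_sumr.
by congr Num.sqrt; apply: eq_bigr => i _; rewrite mxE exprMn.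
Qed.

Lemma frob_norm_sqr m n (A : 'M[R]_(m, n)) :
  frob_norm A ^+ 2 = \sum_i \sum_j A i j ^+ 2.
Proof.
rewrite sqr_sqrtr //; apply: sumr_ge0 => i _; apply: sumr_ge0 => j _.
exact: sqr_ge0.
Qed.

Lemma frob_norm_ge0 m n (A : 'M[R]_(m, n)) : 0 <= frob_norm A.
Proof. exact: sqrtr_ge0. Qed.

Lemma mulmx_entry_inner m n (A : 'M[R]_(m, n)) v i :
  (A *m v) i 0 = inner (row i A)^T v.
Proof. by rewrite mxE; apply: eq_bigr => j _; rewrite !mxE. Qed.

Lemma frob_norm_rows m n (A : 'M[R]_(m, n)) :
  frob_norm A ^+ 2 = \sum_i inner (row i A)^T (row i A)^T.
Proof.
rewrite frob_norm_sqr; apply: eq_bigr => i _; apply: eq_bigr => j _.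
by rewrite !mxE expr2.
Qed.

Lemma l2_norm_mulmx_frob m n (A : 'M[R]_(m, n)) v :
  l2_norm (A *m v) <= frob_norm A * l2_norm v.
Proof.
rewrite -ler_sqr ?nnegrE ?mulr_ge0 ?l2_norm_ge0 ?frob_norm_ge0 //.
rewrite exprMn !l2_norm_sqr frob_norm_rows mulr_suml; apply: ler_sum => i _.
by rewrite mulmx_entry_inner -expr2 cauchy_schwarz_sqr.
Qed.

Lemma l2_ball0 n : @l2_ball R n 0.
Proof. by rewrite /l2_ball /= l2_norm0. Qed.

Lemma op_norm_ub m n (A : 'M[R]_(m, n)) v :
  l2_norm v <= 1 -> l2_norm (A *m v) <= op_norm A.
Proof.
move=> v1; apply: ub_le_sup; last by exists v.
exists (frob_norm A) => _ [x x1 <-]; apply: le_trans (l2_norm_mulmx_frob _ _) _.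
by rewrite ler_piMr ?frob_norm_ge0.
Qed.

Lemma op_norm_le m n (A : 'M[R]_(m, n)) C :
  (forall v, l2_norm v <= 1 -> l2_norm (A *m v) <= C) -> op_norm A <= C.
Proof.
move=> AC; apply: ge_sup; first by exists (l2_norm (A *m 0)), 0 => //; exact: l2_ball0.
by move=> _ [x x1 <-]; exact: AC.
Qed.

Lemma op_norm_ge0 m n (A : 'M[R]_(m, n)) : 0 <= op_norm A.
Proof.
by apply: le_trans (op_norm_ub A (l2_ball0 n)); exact: l2_norm_ge0.
Qed.

Lemma op_norm_inner m n (A : 'M[R]_(m, n)) u v : l2_norm u <= 1 -> l2_norm v <= 1 ->
  inner (A *m v) u <= op_norm A.
Proof.
move=> u1 v1; apply: le_trans (ler_norm _) _.
apply: le_trans (cauchy_schwarz _ _) (le_trans _ (op_norm_ub A v1)).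
by rewrite ler_piMr ?l2_norm_ge0.
Qed.

Lemma op_norm_le_inner m n (A : 'M[R]_(m, n)) C : 0 <= C ->
  (forall u v, l2_norm u <= 1 -> l2_norm v <= 1 -> inner (A *m v) u <= C) ->
  op_norm A <= C.
Proof.
move=> C0 AC; apply: op_norm_le => v v1.
have [s0|s0] := leP (l2_norm (A *m v)) 0; first exact: le_trans C0.
have := AC ((l2_norm (A *m v))^-1 *: (A *m v)) v _ v1.
rewrite innerZr -l2_norm_sqr expr2 mulrA mulVf ?gt_eqF // mul1r; apply.
by rewrite l2_normZ gtr0_norm ?invr_gt0 // mulVf ?gt_eqF.
Qed.

Section coefficients.
Variables (n d1 d2 : nat) (A : 'I_n -> 'M[R]_(d1, d2)).

(** The vector [T(U, V)] of the outline: it turns the bilinear form into a linear one in the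
    coefficients. *)
Definition bilinear_col (U : 'cV[R]_d1) (V : 'cV[R]_d2) : 'cV[R]_n :=
  \col_i inner (A i *m V) U.

Lemma inner_lin_comb x U V :
  inner (lin_comb A x *m V) U = inner x (bilinear_col U V).
Proof.
rewrite /lin_comb mulmx_suml innerC inner_sumr; apply: eq_bigr => i _.
by rewrite -scalemxAl innerZr mxE innerC.
Qed.

(** Each entry is a linear form in [x], hence measurable once [x] is random. *)
Lemma lin_comb_mulmx_entry x (v : 'cV[R]_d2) k :
  (lin_comb A x *m v) k 0 = inner x (\col_i (A i *m v) k 0).
Proof.
rewrite /lin_comb mulmx_suml summxE; apply: eq_bigr => i _.
by rewrite -scalemxAl !mxE.
Qed.

Lemma bilinear_col_le U V : l2_norm U <= 1 -> l2_norm V <= 1 ->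
  l2_norm (bilinear_col U V) <= Num.sqrt (\sum_i op_norm (A i) ^+ 2).
Proof.
move=> U1 V1; apply: ler_wsqrtr; apply: ler_sum => i _.
rewrite mxE -real_normK ?num_real // ler_sqr ?nnegrE ?op_norm_ge0 //.
apply: le_trans (cauchy_schwarz _ _) (le_trans _ (op_norm_ub _ V1)).
by rewrite ler_piMr ?l2_norm_ge0.
Qed.

(** A crude bound, which serves to show that the set defining [sigma_star] is bounded above. *)
Lemma op_norm_lin_comb_le w : l2_norm w <= 1 ->
  op_norm (lin_comb A w) <= Num.sqrt (\sum_i op_norm (A i) ^+ 2).
Proof.
move=> w1; apply: op_norm_le_inner => [|u v u1 v1]; first exact: sqrtr_ge0.
rewrite inner_lin_comb; apply: le_trans (ler_norm _) _.
apply: le_trans (cauchy_schwarz _ _) (le_trans _ (bilinear_col_le u1 v1)).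
by rewrite ler_piMl ?l2_norm_ge0.
Qed.

Lemma sigma_star_ub w : l2_norm w <= 1 -> op_norm (lin_comb A w) <= sigma_star A.
Proof.
move=> w1; apply: ub_le_sup; last by exists w.
by eexists => _ [x x1 <-]; exact: op_norm_lin_comb_le.
Qed.

Lemma sigma_star_ge0 : 0 <= sigma_star A.
Proof. by apply: le_trans (sigma_star_ub (l2_ball0 n)); exact: op_norm_ge0. Qed.

Lemma upsilon_ge0 : 0 <= upsilon A.
Proof.
have [ub|nub] := pselect (has_ubound [set frob_norm (lin_comb A w) | w in @l2_ball R n]).
  apply: le_trans (ub_le_sup ub _); first exact: (frob_norm_ge0 (lin_comb A 0)).
  by exists 0 => //; exact: l2_ball0.
(* [sup] takes the default value 0 on a set without an upper bound. *)
by rewrite /upsilon sup_out // => -[].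
Qed.

Lemma sigma_ge0 : 0 <= sigma A.
Proof. by rewrite addr_ge0 ?sqrtr_ge0. Qed.

Lemma sigma_diamond_ge0 : 0 <= sigma_diamond A.
Proof. exact: sqrtr_ge0. Qed.

(** Duality: the supremum is tested at [w = y / l2_norm y], where the bilinear form at [u] and [v]
    equals [l2_norm y]. *)
Lemma bilinear_col_sigma_star u v : l2_norm u <= 1 -> l2_norm v <= 1 ->
  l2_norm (bilinear_col u v) <= sigma_star A.
Proof.
move=> u1 v1; set y := bilinear_col u v.
have [y0|y0] := leP (l2_norm y) 0; first exact: le_trans sigma_star_ge0.
have w1 : l2_norm ((l2_norm y)^-1 *: y) <= 1.
  by rewrite l2_normZ gtr0_norm ?invr_gt0 // mulVf ?gt_eqF.
apply: le_trans (sigma_star_ub w1); apply: le_trans (op_norm_inner _ u1 v1).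
by rewrite inner_lin_comb innerC innerZr -l2_norm_sqr expr2 mulrA mulVf ?gt_eqF ?mul1r.
Qed.

Lemma sum_l2_norm_sqr_le (m k : nat) (B : 'I_n -> 'M[R]_(m, k)) v : l2_norm v <= 1 ->
  \sum_i inner (B i *m v) (B i *m v) <= op_norm (\sum_i (B i)^T *m B i).
Proof.
move=> v1; apply: le_trans (op_norm_inner _ v1 v1).
rewrite mulmx_suml innerC inner_sumr; apply: ler_sum => i _.
by rewrite inner_trmx mulmxA innerC.
Qed.

(** Each of the two sums is at most the square of one summand of [sigma A], and
    [a ^+ 2 + b ^+ 2 <= (a + b) ^+ 2] for nonnegative [a], [b]. *)
Lemma sigma_sqr_le u v : l2_norm u <= 1 -> l2_norm v <= 1 ->
  \sum_i (inner ((A i)^T *m u) ((A i)^T *m u) + inner (A i *m v) (A i *m v)) <=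
  sigma A ^+ 2.
Proof.
move=> u1 v1; rewrite big_split /=.
have h1 := sum_l2_norm_sqr_le A v1.
have := sum_l2_norm_sqr_le (fun i => (A i)^T) u1.
under [in X in _ <= X]eq_bigr do rewrite trmxK.
move=> h2; apply: le_trans (lerD h2 h1) _.
rewrite /sigma.
set x := op_norm _; set y := op_norm _.
have x0 : 0 <= x by exact: op_norm_ge0.
have y0 : 0 <= y by exact: op_norm_ge0.
rewrite -[x in x + _]sqr_sqrtr // -[y in _ + y]sqr_sqrtr //.
have := sqrtr_ge0 x; have := sqrtr_ge0 y.
by move: (Num.sqrt x) (Num.sqrt y) => a b ? ?; nra.
Qed.

End coefficients.
End norms.

(** * The smoothed bilinear form *)

Section bilinear.
Variables (R : realType) (Om1 Om2 : finType) (d1 d2 : nat) (p : R).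
Variables (w1 : Om1 -> R) (w2 : Om2 -> R).
Variables (W1 : Om1 -> 'cV[R]_d1) (W2 : Om2 -> 'cV[R]_d2).
Variables (u : 'cV[R]_d1) (v : 'cV[R]_d2).
Hypotheses (p0 : 0 < p) (w1_ge0 : forall o, 0 <= w1 o) (w2_ge0 : forall o, 0 <= w2 o).

(** The first hypothesis is applied with [W2] frozen and [y = A *m W2 o2]. The second is then
    applied to [A^T *m u] and to each row of [A]; the sum over rows produces the Frobenius term. *)
Lemma bilinear_second_moment (A : 'M[R]_(d1, d2)) :
  \sum_o w2 o = 1 ->
  (forall y, \sum_o w1 o * inner y (W1 o) ^+ 2 <= inner y u ^+ 2 + inner y y / p) ->
  (forall y, \sum_o w2 o * inner y (W2 o) ^+ 2 <= inner y v ^+ 2 + inner y y / p) ->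
  \sum_o2 \sum_o1 w2 o2 * w1 o1 * inner (A *m W2 o2) (W1 o1) ^+ 2 <=
  inner (A *m v) u ^+ 2 +
  (inner (A^T *m u) (A^T *m u) + inner (A *m v) (A *m v)) / p +
  frob_norm A ^+ 2 / p ^+ 2.
Proof.
move=> sum2 m1 m2.
apply: (@le_trans _ _ (\sum_o2 (w2 o2 * inner (A^T *m u) (W2 o2) ^+ 2 +
    \sum_i w2 o2 * inner (row i A)^T (W2 o2) ^+ 2 / p))).
  apply: ler_sum => o2 _; rewrite -inner_trmx.
  have -> : \sum_i w2 o2 * inner (row i A)^T (W2 o2) ^+ 2 / p =
      w2 o2 * (inner (A *m W2 o2) (A *m W2 o2) / p).
    rewrite [inner (A *m _) _]/inner mulr_suml mulr_sumr; apply: eq_bigr => i _.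
    by rewrite -mulmx_entry_inner; ring.
  rewrite -mulrDr; under eq_bigr do rewrite -mulrA.
  by rewrite -mulr_sumr ler_wpM2l.
rewrite big_split /=.
have hB : \sum_o \sum_i w2 o * inner (row i A)^T (W2 o) ^+ 2 / p <=
    inner (A *m v) (A *m v) / p + frob_norm A ^+ 2 / p ^+ 2.
  rewrite exchange_big /= frob_norm_rows [inner (A *m _) _]/inner !mulr_suml -big_split /=.
  apply: ler_sum => i _; rewrite -mulr_suml ler_pdivrMr // mulrDl.
  apply: le_trans (m2 _) _.
  by rewrite !mulmx_entry_inner -expr2 expr2 invfM mulrA !divfK ?gt_eqF // expr2.
apply: le_trans (lerD (m2 _) hB) _.
by rewrite -inner_trmx mulrDl !addrA.
Qed.

(** Two successive smoothings, each losing a factor 2 in size and 20 in probability: first [v] is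
    replaced by [W2] against [A^T *m u], then [u] by [W1] against [A *m W2 o2]. *)
Lemma bilinear_anticoncentration (A : 'M[R]_(d1, d2)) :
  (forall y, 20^-1 <=
     \sum_o w1 o * (`|inner y u| / 2 <= `|inner y (W1 o)|)%R%:R) ->
  (forall y, 20^-1 <=
     \sum_o w2 o * (`|inner y v| / 2 <= `|inner y (W2 o)|)%R%:R) ->
  400^-1 <= \sum_o2 \sum_o1 w2 o2 * w1 o1 *
    (`|inner (A *m v) u| / 4 <= `|inner (A *m W2 o2) (W1 o1)|)%R%:R.
Proof.
move=> a1 a2; rewrite inner_trmx; set z := inner _ v.
apply: (@le_trans _ _ (20^-1 * \sum_o w2 o *
    (`|z| / 2 <= `|inner (A^T *m u) (W2 o)|)%R%:R)).
  by rewrite (_ : 400^-1 = 20^-1 * 20^-1) ?ler_wpM2l ?a2 //; lra.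
rewrite mulr_sumr; apply: ler_sum => o2 _; rewrite mulrCA.
under eq_bigr do rewrite -mulrA.
rewrite -mulr_sumr ler_wpM2l //.
case: (leP (`|z| / 2) _) => [zle|_]; last first.
  by rewrite mulr0; apply: sumr_ge0 => o1 _; rewrite mulr_ge0 // ler0n.
rewrite mulr1; apply: le_trans (a1 (A *m W2 o2)) _.
apply: ler_sum => o1 _; rewrite ler_wpM2l //.
move: zle; rewrite -inner_trmx -/(inner (A *m W2 o2) u) => zle.
by case: (leP (`|inner _ u| / 2)); case: (leP (`|z| / 4)); rewrite ?ler01 //; lra.
Qed.
End bilinear.

(* A substitute for Hoelder's inequality with the density [r] in [L^(p/(p-1))]:
   only the second moment of [r] is needed. *)
Lemma density_mul_le (R : realType) (p r f : R) : 2 <= p -> 0 <= r -> 0 <= f ->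
  r * f <= f `^ p + expR 4 * (r + r ^+ 2 * expR (- (2 * p))).
Proof.
move=> p2 r0 f0; set s := r * expR (- (2 * p)).
have s0 : 0 <= s by rewrite mulr_ge0 ?expR_ge0.
have e0 : 0 < expR 4 :> R := expR_gt0 4.
have rE : r = expR (2 * p) * s.
  by rewrite /s mulrCA -expRD subrr expR0 mulr1.
(* Below this threshold the second summand suffices. Above it [f]^ (p - 1) >= r[, because]4 * (p -
   1) >= 2 * p[and](1 + s) [^ (p - 1) >= s] for [p >= 2]. *)
have [fs|fs] := leP f (expR 4 * (1 + s)).
  apply: (@le_trans _ _ (r * (expR 4 * (1 + s)))); first exact: ler_wpM2l.
  have -> : r * (expR 4 * (1 + s)) = expR 4 * (r + r ^+ 2 * expR (- (2 * p))).
    by rewrite /s; ring.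
  by rewrite lerDr powR_ge0.
have m1 : 1 <= 1 + s by lra.
have -> : f `^ p = f * f `^ (p - 1).
  rewrite -[f in f * _]powRr1 // -powRD; first by congr powR; lra.
  by apply/implyP => _; rewrite gt_eqF //; apply: le_lt_trans fs; rewrite mulr_ge0 //; lra.
rewrite mulrC; apply: (@le_trans _ _ (f * f `^ (p - 1))); last first.
  rewrite lerDl mulr_ge0 ?expR_ge0 // addr_ge0 // mulr_ge0 ?sqr_ge0 ?expR_ge0 //.
apply: ler_wpM2l => //.
apply: (@le_trans _ _ ((expR 4 * (1 + s)) `^ (p - 1))); last first.
  by apply: ge0_ler_powR; rewrite ?nnegrE ?mulr_ge0 //; lra.
rewrite powRM ?expR_ge0 //; last by lra.
rewrite {1}rE; apply: ler_pM; rewrite ?expR_ge0 //.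
  by rewrite -expRM ler_expR; lra.
apply: (@le_trans _ _ ((1 + s) `^ 1)); last by apply: ler_powR; lra.
by rewrite powRr1; lra.
Qed.

(** The law [mu] and the truncated vectors [Y] are chosen before [x], so the right-hand side can be
    averaged over a random [x]; the supremum over [u] and [v] is absorbed by the densities. The
    parameter [lam] is a scale left free for the tail bound. *)
Lemma bilinear_smoothing (R : realType) (n d1 d2 : nat)
    (A : 'I_n -> 'M[R]_(d1, d2)) (p K : R) : 2 <= p -> 0 < K ->
  800 * (sigma_star A ^+ 2 + sigma A ^+ 2 / p + sigma_diamond A ^+ 2 / p ^+ 2)
    <= K ^+ 2 ->
  exists (Om : finType) (mu : Om -> R) (Y : Om -> 'cV[R]_n),
  [/\ forall o, 0 <= mu o, \sum_o mu o = 1, forall o, l2_norm (Y o) <= K &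
   forall x lam, 0 < lam -> op_norm (lin_comb A x) <=
     3200 * lam * (\sum_o mu o * (`|inner x (Y o)| / lam) `^ p + 2 * expR 4)].
Proof.
move=> p2 K0 KB; have p0 : 0 < p by lra.
have [Om1 [mu1 [W1 [mu1_ge0 mu1_sum dens1]]]] := @sign_smoothing R d1 p p0.
have [Om2 [mu2 [W2 [mu2_ge0 mu2_sum dens2]]]] := @sign_smoothing R d2 p p0.
pose T (o : Om2 * Om1) := bilinear_col A (W1 o.2) (W2 o.1).
pose Y o := if l2_norm (T o) <= K then T o else 0.
exists (Om2 * Om1)%type, (fun o => mu2 o.1 * mu1 o.2), Y; split.
- by move=> o; rewrite mulr_ge0.
- rewrite -(pair_bigA _ (fun o2 o1 => mu2 o2 * mu1 o1)) /= -mu2_sum.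
  by apply: eq_bigr => o _; rewrite -mulr_sumr mu1_sum mulr1.
- by move=> o; rewrite /Y; case: ifP => // _; rewrite l2_norm0 ltW.
move=> x lam lam0.
set Q := \sum_o _.
have Q0 : 0 <= Q by apply: sumr_ge0 => o _; rewrite !mulr_ge0 ?powR_ge0.
have e0 : 0 < expR 4 :> R := expR_gt0 4.
apply: op_norm_le_inner => [|u v u1 v1].
  apply: mulr_ge0; first by apply: mulr_ge0; [exact: ler0n | exact: ltW].
  by apply: addr_ge0 => //; apply: mulr_ge0 => //; exact: ltW.
set X := lin_comb A x; set z := inner (X *m v) u.
have [r1 [r1_ge0 r1_sum r1_sqr m1 a1]] := dens1 u u1.
have [r2 [r2_ge0 r2_sum r2_sqr m2 a2]] := dens2 v v1.
pose w1 o := mu1 o * r1 o; pose w2 o := mu2 o * r2 o.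
have w1_ge0 o : 0 <= w1 o by exact: mulr_ge0.
have w2_ge0 o : 0 <= w2 o by exact: mulr_ge0.
pose w (o : Om2 * Om1) := w2 o.1 * w1 o.2.
have w_ge0 o : 0 <= w o by exact: mulr_ge0.
have pairE (F : Om2 * Om1 -> R) : \sum_o2 \sum_o1 F (o2, o1) = \sum_o F o.
  by rewrite pair_bigA; apply: eq_bigr => -[].
have anti : 400^-1 <= \sum_o w o *
    (`|z| / 4 <= `|inner (X *m W2 o.1) (W1 o.2)|)%R%:R.
  rewrite -pairE; exact: (bilinear_anticoncentration w1_ge0 w2_ge0 X a1 a2).
(* By Chebyshev the truncation costs probability at most 1/800, half of the 1/400 in [anti]. *)
have second : \sum_o w o * l2_norm (T o) ^+ 2 <= K ^+ 2 / 800.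
  rewrite ler_pdivlMr ?ltr0n // mulrC; apply: le_trans KB.
  rewrite ler_pM2l ?ltr0n //.
  have -> : \sum_o w o * l2_norm (T o) ^+ 2 = \sum_i \sum_o2 \sum_o1
      w2 o2 * w1 o1 * inner (A i *m W2 o2) (W1 o1) ^+ 2.
    transitivity (\sum_i \sum_o w o * inner (A i *m W2 o.1) (W1 o.2) ^+ 2).
      rewrite exchange_big /=; apply: eq_bigr => o _.
      by rewrite l2_norm_sqr mulr_sumr; apply: eq_bigr => i _; rewrite mxE expr2.
    by apply: eq_bigr => i _; rewrite -pairE.
  apply: le_trans (ler_sum _ (fun i _ =>
    bilinear_second_moment p0 w2_ge0 (A i) r2_sum m1 m2)) _.
  rewrite !big_split /= -!mulr_suml; apply: lerD; first apply: lerD.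
  - apply: (@le_trans _ _ (l2_norm (bilinear_col A u v) ^+ 2)).
      by rewrite l2_norm_sqr; apply: ler_sum => i _; rewrite mxE expr2.
    by rewrite ler_sqr ?nnegrE ?l2_norm_ge0 ?sigma_star_ge0 ?bilinear_col_sigma_star.
  - by rewrite ler_pM2r ?invr_gt0 //; exact: sigma_sqr_le.
  - rewrite ler_pM2r ?invr_gt0 ?exprn_gt0 // sqr_sqrtr //.
    by apply: sumr_ge0 => i _; exact: sqr_ge0.
have low : `|z| / 3200 <= \sum_o w o * `|inner x (Y o)|.
  (* When [T o] is truncated the bracket is nonpositive; otherwise it is at most the indicator.
     Averaging gives the factor (1/400 - 1/800) / 4 = 1/3200. *)
  have pt o : `|z| / 4 * ((`|z| / 4 <= `|inner (X *m W2 o.1) (W1 o.2)|)%R%:R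
      - l2_norm (T o) ^+ 2 / K ^+ 2) <= `|inner x (Y o)|.
    have q0 : 0 <= l2_norm (T o) ^+ 2 / K ^+ 2 by rewrite divr_ge0 ?sqr_ge0.
    have z0 : 0 <= `|z| / 4 by rewrite divr_ge0.
    rewrite /Y; case: (leP (l2_norm (T o)) K) => [TK|TK]; last first.
      apply: le_trans (normr_ge0 _); rewrite mulr_ge0_le0 // subr_le0.
      apply: (@le_trans _ _ 1); first by rewrite lern1 leq_b1.
      rewrite ler_pdivlMr ?exprn_gt0 // mul1r.
      by rewrite ler_sqr ?nnegrE; [exact: ltW | exact: ltW | exact: l2_norm_ge0].
    rewrite inner_lin_comb -/(T o); case: (leP (`|z| / 4)) => [le1|_].
      by apply: le_trans le1; rewrite ler_piMr // gerBl.
    by apply: le_trans (normr_ge0 _); rewrite mulr_ge0_le0 // sub0r oppr_le0.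
  apply: le_trans (ler_sum _ (fun o _ => ler_wpM2l (w_ge0 o) (pt o))).
  under eq_bigr do rewrite mulrCA mulrBr mulrA.
  rewrite -mulr_sumr sumrB -mulr_suml.
  have h : (\sum_o w o * l2_norm (T o) ^+ 2) / K ^+ 2 <= 800^-1.
    by rewrite ler_pdivrMr ?exprn_gt0 // mulrC.
  rewrite (_ : `|z| / 3200 = `|z| / 4 * (400^-1 - 800^-1)); last by field.
  by apply: ler_wpM2l; [rewrite divr_ge0 | exact: lerB].
pose mu o := mu2 o.1 * mu1 o.2; pose r o := r2 o.1 * r1 o.2.
have wE o : w o = mu o * r o by rewrite /w /w1 /w2 /mu /r; ring.
have mu_ge0 o : 0 <= mu o by exact: mulr_ge0.
have r_ge0 o : 0 <= r o by exact: mulr_ge0.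
have r_sum : \sum_o mu o * r o = 1.
  under eq_bigr do rewrite -wE.
  rewrite -pairE -[RHS]r2_sum; apply: eq_bigr => o _.
  by rewrite /w /= -mulr_sumr r1_sum mulr1.
have r_sqr : \sum_o mu o * r o ^+ 2 <= expR (2 * p).
  rewrite -pairE.
  have -> : \sum_o2 \sum_o1 mu (o2, o1) * r (o2, o1) ^+ 2 =
      (\sum_o mu2 o * r2 o ^+ 2) * (\sum_o mu1 o * r1 o ^+ 2).
    rewrite mulr_suml; apply: eq_bigr => o2 _; rewrite mulr_sumr.
    by apply: eq_bigr => o1 _; rewrite /mu /r /=; ring.
  rewrite (_ : 2 * p = p + p) ?expRD; last by ring.
  by apply: ler_pM => //; apply: sumr_ge0 => o _; rewrite mulr_ge0 ?sqr_ge0.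
(* Averaging [density_mul_le] over [mu]: the mass of [r] gives one [expR 4], and [expR (- (2 * p))]
   cancels the second moment of [r], giving at most another. *)
have up : \sum_o w o * (`|inner x (Y o)| / lam) <= Q + 2 * expR 4.
  apply: (@le_trans _ _ (\sum_o (mu o * (`|inner x (Y o)| / lam) `^ p +
      expR 4 * (mu o * r o + mu o * r o ^+ 2 * expR (- (2 * p)))))).
    apply: ler_sum => o _; rewrite wE -mulrA.
    have := density_mul_le p2 (r_ge0 o) (divr_ge0 (normr_ge0 (inner x (Y o))) (ltW lam0)).
    move=> /(ler_wpM2l (mu_ge0 o)) /le_trans; apply.
    by rewrite le_eqVlt; apply/orP; left; apply/eqP; ring.
  rewrite big_split /= lerD2l -mulr_sumr big_split /= r_sum -mulr_suml.
  rewrite mulrC ler_pM2r // (_ : 2 = 1 + 1) // lerD2l.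
  by rewrite expRN ler_pdivrMr ?expR_gt0 // mul1r.
have : `|z| / 3200 <= lam * (Q + 2 * expR 4).
  apply: le_trans low _; rewrite mulrC -ler_pdivrMr // mulr_suml.
  by under eq_bigr do rewrite -mulrA.
rewrite ler_pdivrMr ?ltr0n // [leRHS]mulrC mulrA => h.
by apply: le_trans (ler_norm _) h.
Qed.

(** * Gaussian moments *)

(** The Radon-Nikodym derivative agrees almost everywhere with [normal_pdf], as both have the same
    integral over every measurable set. *)
Lemma ge0_integral_normal_prob (R : realType) (m s : R)
    (f : measurableTypeR R -> \bar R) :
  (forall x, 0 <= f x)%E -> measurable_fun setT f ->
  (\int[normal_prob m s]_x f x =
   \int[lebesgue_measure]_x (f x * (normal_pdf m s x)%:E))%E.
Proof.
move=> f0 mf.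
have dom := normal_prob_dominates m s.
rewrite -(@Radon_Nikodym_SigmaFinite.change_of_variables _ _ _
  (normal_prob m s) (@lebesgue_measure R) dom f setT f0 measurableT mf).
apply: ae_eq_integral => //.
- apply: emeasurable_funM => //.
  exact: measurable_int (Radon_Nikodym_SigmaFinite.f_integrable dom).
- apply: emeasurable_funM => //; apply/measurable_EFinP.
  exact: measurable_normal_pdf.
- apply: ae_eqe_mul2l; apply: integral_ae_eq => //.
  + exact: Radon_Nikodym_SigmaFinite.f_integrable dom.
  + by apply/measurable_EFinP; exact: measurable_normal_pdf.
  + by move=> E _ mE; rewrite -(Radon_Nikodym_SigmaFinite.f_integral dom).
Qed.

(** The integrand times the standard density is [Num.sqrt 2] times the centered normal density of
    variance 2. *)
Lemma normal_exp_moment (R : realType) :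
  (\int[normal_prob (0 : R) 1]_x (expR (x ^+ 2 / 4))%:E = (Num.sqrt 2)%:E)%E.
Proof.
rewrite ge0_integral_normal_prob; last 2 first.
- by move=> x; rewrite lee_fin expR_ge0.
- apply/measurable_EFinP; apply: measurableT_comp => //.
  by apply: measurable_funM => //; exact: measurable_funX.
have s0 : Num.sqrt 2 != 0 :> R by rewrite sqrtr_eq0 -ltNge.
transitivity (\int[@lebesgue_measure R]_x
    ((Num.sqrt 2)%:E * (normal_pdf 0 (Num.sqrt 2) x)%:E))%E; last first.
  rewrite ge0_integralZl_EFin ?sqrtr_ge0 //; last 2 first.
  - by move=> x _; rewrite lee_fin normal_pdf_ge0.
  - by apply/measurable_EFinP; exact: measurable_normal_pdf.
  by rewrite integral_normal_pdf mule1.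
apply: eq_integral => x _; rewrite -!EFinM; congr EFin.
rewrite !normal_pdfE ?oner_eq0 // /normal_peak /normal_fun subr0 sqr_sqrtr // expr1n.
have -> : Num.sqrt (2 * pi *+ 2) = Num.sqrt 2 * Num.sqrt (1 * pi *+ 2) :> R.
  by rewrite -sqrtrM //; congr Num.sqrt; move: pi => q; ring.
move: (Num.sqrt (1 * pi *+ 2)) => q; rewrite invfM !mulrA mulfV // mul1r mulrC mulrA -expRD.
rewrite [RHS]mulrC; congr (expR _ * _); by field.
Qed.

Lemma gauss_Lp_le (R : realType) (p : R) : 1 <= p ->
  (gauss_Lp p <= (4 * Num.sqrt p)%:E)%E.
Proof.
move=> p1; have p0 : 0 < p by lra.
have sp0 : 0 < Num.sqrt p by rewrite sqrtr_gt0.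
have pt (x : R) : `|x| `^ p <= (2 * Num.sqrt p) `^ p * expR (x ^+ 2 / 4).
  have -> : expR (x ^+ 2 / 4) = expR (`|x| ^+ 2 / p / 4) `^ p.
    by rewrite -expRM real_normK ?num_real //; congr expR; field; rewrite gt_eqF.
  rewrite -powRM ?expR_ge0 ?mulr_ge0 ?sqrtr_ge0 //.
  apply: ge0_ler_powR; rewrite ?nnegrE ?mulr_ge0 ?expR_ge0 ?sqrtr_ge0 //; first exact: ltW.
  have -> : `|x| ^+ 2 / p / 4 = (`|x| / Num.sqrt p) ^+ 2 / 4.
    by rewrite expr_div_n sqr_sqrtr // ltW.
  rewrite mulrAC -ler_pdivrMr //.
  have := expR_ge1Dx ((`|x| / Num.sqrt p) ^+ 2 / 4).
  move: (`|x| / _) => y h; apply: (@le_trans _ _ (2 * (1 + y ^+ 2 / 4))); last by lra.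
  by have := sqr_ge0 (y - 1); nra.
have int_le : (\int[normal_prob (0 : R) 1]_x (`|x| `^ p)%:E <=
    ((4 * Num.sqrt p) `^ p)%:E)%E.
  apply: (@le_trans _ _ (\int[normal_prob (0 : R) 1]_x
      (((2 * Num.sqrt p) `^ p)%:E * (expR (x ^+ 2 / 4))%:E))%E).
    apply: ge0_le_integral.
    - exact: measurableT.
    - by move=> x _; rewrite lee_fin powR_ge0.
    - apply/measurable_EFinP; exact: (measurableT_comp (measurable_powR p)).
    - apply/measurable_EFinP; apply: measurable_funM => //; apply: measurableT_comp => //.
      by apply: measurable_funM => //; exact: measurable_funX.
    - by move=> x _; rewrite -EFinM lee_fin.
  rewrite ge0_integralZl_EFin ?powR_ge0 //; last first.
    apply/measurable_EFinP; apply: measurableT_comp => //.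
    by apply: measurable_funM => //; exact: measurable_funX.
  rewrite normal_exp_moment -EFinM lee_fin.
  rewrite (_ : 4 * Num.sqrt p = (2 * Num.sqrt p) * 2); last by ring.
  rewrite [in leRHS]powRM ?mulr_ge0 ?sqrtr_ge0 //; apply: ler_wpM2l; first exact: powR_ge0.
  apply: (@le_trans _ _ (2 `^ 1)); last by apply: ler_powR => //; lra.
  rewrite powRr1 // -[leRHS]ger0_norm // -sqrtr_sqr.
  by apply: ler_wsqrtr; lra.
have -> : gauss_Lp p = ((gauss_Lp p `^ p) `^ p^-1)%E.
  by rewrite -poweRrM divff ?gt_eqF // poweRe1 // Lnorm_ge0.
have -> : (4 * Num.sqrt p)%:E = ((((4 * Num.sqrt p) `^ p)%:E) `^ p^-1)%E.
  by rewrite poweR_EFin -powRrM divff ?gt_eqF // powRr1 // mulr_ge0 // sqrtr_ge0.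
apply: gt0_ler_poweR; rewrite ?in_itv /= ?leey ?andbT ?poweR_ge0 ?lee_fin ?powR_ge0 //.
  by rewrite invr_ge0 ltW.
by rewrite /gauss_Lp poweR_Lnorm ?gt_eqF.
Qed.

(** * Measurability and the tail bound *)

(** Serves the case [h p = +oo] of the theorem, where a finite bound forces [sigma_star A = 0]. *)
Lemma op_norm_lin_comb_sigma_star (R : realType) (n d1 d2 : nat)
    (A : 'I_n -> 'M[R]_(d1, d2)) x :
  op_norm (lin_comb A x) <= l2_norm x * sigma_star A.
Proof.
apply: op_norm_le_inner => [|u v u1 v1].
  by rewrite mulr_ge0 ?l2_norm_ge0 ?sigma_star_ge0.
rewrite inner_lin_comb; apply: le_trans (ler_norm _) _.
apply: le_trans (cauchy_schwarz _ _) _.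
by rewrite ler_wpM2l ?l2_norm_ge0 ?bilinear_col_sigma_star.
Qed.

Lemma ler_l2_normD (R : realType) n (x y : 'cV[R]_n) :
  l2_norm (x + y) <= l2_norm x + l2_norm y.
Proof.
rewrite -ler_sqr ?nnegrE ?addr_ge0 ?l2_norm_ge0 // sqrrD !l2_norm_sqr.
have -> : inner (x + y) (x + y) = inner x x + inner x y *+ 2 + inner y y.
  rewrite /inner -sumrMnl -!big_split /=; apply: eq_bigr => i _.
  by rewrite !mxE; ring.
rewrite lerD2r lerD2l lerMn2r /=; apply: le_trans (ler_norm _) (cauchy_schwarz _ _).
Qed.

Lemma rat_vector_approx (R : realType) n (v : 'cV[R]_n) (eps : R) : 0 < eps ->
  exists q : 'cV[rat]_n, l2_norm (v - map_mx ratr q) <= eps.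
Proof.
(* [n.+1] instead of [n] keeps the divisor positive in dimension 0. *)
move=> eps0; pose del := eps / Num.sqrt n.+1%:R.
have s0 : 0 < Num.sqrt n.+1%:R :> R by rewrite sqrtr_gt0 ltr0n.
have del0 : 0 < del by rewrite divr_gt0.
have ex i : exists q : rat, `|v i 0 - ratr q| <= del.
  have [|q] := @rat_in_itvoo R (v i 0 - del) (v i 0 + del); first by lra.
  rewrite in_itv /= => /andP[q1 q2]; exists q.
  by rewrite ler_norml; apply/andP; split; lra.
pose q : 'cV[rat]_n := \col_i projT1 (cid (ex i)).
exists q; rewrite -[leRHS]ger0_norm ?(ltW eps0) // -sqrtr_sqr; apply: ler_wsqrtr.
apply: (@le_trans _ _ (\sum_(i < n) eps ^+ 2 / n.+1%:R)).
  apply: ler_sum => i _; rewrite !mxE.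
  have qi := projT2 (cid (ex i)); rewrite -real_normK ?num_real //.
  apply: (@le_trans _ _ (del ^+ 2)); first by rewrite ler_sqr ?nnegrE ?(ltW del0).
  by rewrite /del expr_div_n sqr_sqrtr ?ler0n.
rewrite sumr_const card_ord -[_ *+ n]mulr_natl mulrCA.
by rewrite ler_piMr ?sqr_ge0 // ler_pdivrMr ?ltr0n // mul1r ler_nat.
Qed.

Lemma l2_norm_mulmx (R : realType) m n (A : 'M[R]_(m, n)) v :
  l2_norm (A *m v) <= op_norm A * l2_norm v.
Proof.
have [v0|v0] := leP (l2_norm v) 0.
  have -> : l2_norm v = 0 by apply/eqP; rewrite eq_le v0 l2_norm_ge0.
  rewrite mulr0; apply: le_trans (l2_norm_mulmx_frob _ _) _.
  by rewrite mulr_ge0_le0 ?frob_norm_ge0.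
rewrite -ler_pdivrMr //.
have := @op_norm_ub _ _ _ A ((l2_norm v)^-1 *: v).
rewrite -scalemxAr !l2_normZ gtr0_norm ?invr_gt0 // mulVf ?gt_eqF // mulrC.
exact.
Qed.

(** Reduces the supremum over the ball to countably many tests, for measurability. The homogeneous
    form of the test spares approximating inside the ball. *)
Lemma op_norm_le_rat (R : realType) m n (A : 'M[R]_(m, n)) (r : R) : 0 <= r ->
  (forall q : 'cV[rat]_n,
     l2_norm (A *m map_mx ratr q) <= r * l2_norm (map_mx ratr q : 'cV[R]_n)) ->
  op_norm A <= r.
Proof.
move=> r0 Ar; apply: op_norm_le => v v1.
apply/ler_addgt0Pr => eps eps0.
have F0 := frob_norm_ge0 A.
(* An approximation error [e] costs [(r + frob_norm A) * e]; the added 1 makes the divisor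
   positive. *)
have c0 : 0 < r + frob_norm A + 1 by lra.
have [q qv] := rat_vector_approx v (divr_gt0 eps0 c0).
set w : 'cV[R]_n := map_mx ratr q in qv.
have -> : v = w + (v - w) by rewrite addrC subrK.
rewrite mulmxDr; apply: le_trans (ler_l2_normD _ _) _.
have w1 : l2_norm w <= 1 + l2_norm (v - w).
  have -> : l2_norm (v - w) = l2_norm (w - v).
    by rewrite -opprB -scaleN1r l2_normZ normrN1 mul1r.
  rewrite -{1}[w](subrK v) addrC.
  by apply: le_trans (ler_l2_normD _ _) _; rewrite lerD2r.
set e := l2_norm (v - w) in qv w1 *.
have e0 : 0 <= e := l2_norm_ge0 _.
have h1 : l2_norm (A *m w) <= r * (1 + e).
  by apply: le_trans (Ar q) _; exact: ler_wpM2l.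
have h2 : l2_norm (A *m (v - w)) <= frob_norm A * e := l2_norm_mulmx_frob _ _.
have h3 : (r + frob_norm A + 1) * e <= eps by rewrite mulrC -ler_pdivlMr.
apply: le_trans (lerD h1 h2) _; nra.
Qed.

(** 3200 and [2 * expR 4] come from [bilinear_smoothing]; 116 = 29 * 4 combines the 29 in the radius
    [K] with the 4 of [gauss_Lp_le]; the summand 1 is the threshold for [Q]. *)
Definition tail_constant (R : realType) : R := 3200 * 116 * (1 + 2 * expR 4).

Lemma tail_constant_gt0 (R : realType) : 0 < tail_constant R.
Proof.
have e0 : 0 < expR 4 :> R := expR_gt0 4.
apply: mulr_gt0; first by apply: mulr_gt0; rewrite ltr0n.
by lra.
Qed.

Section random_matrix.
Variables (R : realType) (d : measure_display) (T : measurableType d).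
Variables (P : probability T R) (n d1 d2 : nat) (xi : random_vector P n).
Variable A : 'I_n -> 'M[R]_(d1, d2).

Lemma measurable_inner_rv (y : 'cV[R]_n) :
  measurable_fun setT (fun omega => inner (rv_value xi omega) y).
Proof.
rewrite /inner; apply: measurable_sum => i.
apply: measurable_funM => //.
rewrite (_ : (fun omega => _) = xi i); first exact: measurable_funP.
by apply/funext => omega; rewrite mxE.
Qed.

(** For nonnegative [r] the event is a countable intersection over rational test vectors, enumerated
    by [unpickle]; codes of no vector contribute [setT]. *)
Lemma measurable_op_norm_le (r : R) :
  measurable [set omega | op_norm (lin_comb A (rv_value xi omega)) <= r].
Proof.
have [r0|r0] := leP 0 r; last first.
  rewrite (_ : [set _ | _] = set0) //; apply/seteqP; split => // omega /=.
  by move=> /le_lt_trans => /(_ _ r0); rewrite ltNge op_norm_ge0.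
pose F (q : 'cV[rat]_d2) := [set omega |
  l2_norm (lin_comb A (rv_value xi omega) *m map_mx ratr q) <=
  r * l2_norm (map_mx ratr q : 'cV[R]_d2)].
pose G (k : nat) := if @unpickle 'cV[rat]_d2 k is Some q then F q else setT.
rewrite (_ : [set _ | _] = \bigcap_k G k).
  apply: bigcapT_measurable => k; rewrite /G; case: unpickle => // q.
  rewrite /F -[X in measurable X]setTI.
  pose X omega := l2_norm (lin_comb A (rv_value xi omega) *m map_mx ratr q).
  rewrite (_ : [set _ | _] = X @^-1`
     [set` `]-oo, r * l2_norm (map_mx ratr q : 'cV[R]_d2)]%R]); last first.
    by apply/seteqP; split => omega /=; rewrite in_itv.
  have mf : measurable_fun setT X.
    apply: (@measurableT_comp _ _ _ _ _ _ (@Num.sqrt R)).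
      by apply: continuous_measurable_fun; exact: sqrt_continuous.
    apply: measurable_sum => j.
    apply: measurable_funX.
    by under eq_fun do rewrite lin_comb_mulmx_entry; exact: measurable_inner_rv.
  by apply: mf => //; exact: measurable_itv.
apply/seteqP; split => omega /=.
  move=> Ar k _; rewrite /G; case: unpickle => // q; rewrite /F /=.
  by apply: le_trans (l2_norm_mulmx _ _) _; rewrite ler_wpM2r ?l2_norm_ge0.
move=> Ar; apply: op_norm_le_rat => // q.
by have := Ar (pickle q) Logic.I; rewrite /G pickleK.
Qed.

(** Markov's inequality for [Q]: [a] bounds the [p]-th moment norm of every
    [inner (rv_value xi omega) (Y o)], and the factor [expR (t / p)] in [lam] brings the mean of [Q]
    down to [expR (- t)]. Where [Q <= 1], the smoothing bound gives the claim. *)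
Lemma op_norm_tail (p t H D : R) : 2 <= p -> 0 < H -> 0 < D ->
  sigma_star A * Num.sqrt p + sigma A + sigma_diamond A / Num.sqrt p <= D ->
  (forall v : 'cV[R]_n,
    (Lnorm P p%:E (fun omega => (inner (rv_value xi omega) v)%:E)
     <= H%:E * gauss_Lp p * (l2_norm v)%:E)%E) ->
  ((1 - expR (- t))%:E <= P [set omega |
     (op_norm (lin_comb A (rv_value xi omega)) <=
     tail_constant R * (expR (t / p) * H * D))%R])%E.
Proof.
move=> p2 H0 D0 leD mom; have p0 : 0 < p by lra.
have pn0 : p != 0 by rewrite gt_eqF.
have sp0 : 0 < Num.sqrt p by rewrite sqrtr_gt0.
have sp2 : Num.sqrt p ^+ 2 = p by rewrite sqr_sqrtr // ltW.
(* 29 is the least integer whose square, 841, is at least the 800 of [bilinear_smoothing]. *)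
pose K := 29 * D / Num.sqrt p.
have K0 : 0 < K by rewrite /K divr_gt0 // mulr_gt0 // ltr0n.
have KB : 800 * (sigma_star A ^+ 2 + sigma A ^+ 2 / p + sigma_diamond A ^+ 2 / p ^+ 2)
    <= K ^+ 2.
  rewrite /K expr_div_n sp2 ler_pdivlMr //.
  have -> : 800 * (sigma_star A ^+ 2 + sigma A ^+ 2 / p + sigma_diamond A ^+ 2 / p ^+ 2) * p =
    800 * ((sigma_star A * Num.sqrt p) ^+ 2 + sigma A ^+ 2 +
           (sigma_diamond A / Num.sqrt p) ^+ 2).
    by rewrite expr_div_n exprMn sp2; field.
  have x0 : 0 <= sigma_star A * Num.sqrt p by rewrite mulr_ge0 ?sigma_star_ge0 ?sqrtr_ge0.
  have y0 := sigma_ge0 A.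
  have z0 : 0 <= sigma_diamond A / Num.sqrt p.
    by rewrite divr_ge0 ?sigma_diamond_ge0 ?sqrtr_ge0.
  move: (sigma_star A * Num.sqrt p) (sigma A) (sigma_diamond A / Num.sqrt p) x0 y0 z0 leD.
  move=> x y z x0 y0 z0 leD.
  have : x ^+ 2 + y ^+ 2 + z ^+ 2 <= D ^+ 2.
    apply: (@le_trans _ _ ((x + y + z) ^+ 2)); last first.
      by rewrite ler_sqr ?nnegrE ?(ltW D0) // !addr_ge0.
    by have := mulr_ge0 x0 y0; have := mulr_ge0 x0 z0; have := mulr_ge0 y0 z0; nra.
  have := sqr_ge0 D; rewrite exprMn; move: (D ^+ 2) (x ^+ 2 + _ + _) => a b ? ?.
  by rewrite -natrX; lra.
have [Om [mu [Y [mu_ge0 mu_sum YK smooth]]]] := bilinear_smoothing p2 K0 KB.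
pose a := H * (4 * Num.sqrt p) * K.
have a0 : 0 < a by do 2 (apply: mulr_gt0 => //); apply: mulr_gt0.
pose lam := expR (t / p) * a.
have lam0 : 0 < lam by rewrite mulr_gt0 ?expR_gt0.
have moment o : (\int[P]_omega (`|inner (rv_value xi omega) (Y o)| `^ p)%:E <=
    (a `^ p)%:E)%E.
  have := mom (Y o); set f := (fun omega => (inner (rv_value xi omega) (Y o))%:E).
  move=> fle.
  have {}fle : (Lnorm P p%:E f <= a%:E)%E.
    apply: le_trans fle _; rewrite /a !EFinM; apply: lee_pmul.
    - by rewrite mule_ge0 ?lee_fin ?(ltW H0) // Lnorm_ge0.
    - by rewrite lee_fin l2_norm_ge0.
    - rewrite -EFinM; apply: lee_wpmul2l; first by rewrite lee_fin ltW.
      by apply: gauss_Lp_le; lra.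
    - by rewrite lee_fin.
  have := poweR_Lnorm P f pn0; rewrite /f.
  under [RHS]eq_integral do rewrite abse_EFin poweR_EFin.
  move=> <-; rewrite -poweR_EFin.
  apply: gt0_ler_poweR => //; rewrite ?in_itv /= ?leey ?andbT ?lee_fin ?(ltW a0) ?(ltW p0) //.
  exact: Lnorm_ge0.
pose Q omega := \sum_o mu o * (`|inner (rv_value xi omega) (Y o)| / lam) `^ p.
have mQo o : measurable_fun setT (fun omega =>
    mu o * (`|inner (rv_value xi omega) (Y o)| / lam) `^ p).
  apply: measurable_funM => //.
  apply: (@measurableT_comp _ _ _ _ _ _ (fun x : R => x `^ p)).
    exact: measurable_powR.
  apply: measurable_funM => //.
  by apply: measurableT_comp => //; exact: measurable_inner_rv.
have mQ : measurable_fun setT Q by apply: measurable_sum => o.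
have Q_ge0 omega : 0 <= Q omega.
  by apply: sumr_ge0 => o _; rewrite mulr_ge0 ?powR_ge0.
have intQ : (\int[P]_omega (Q omega)%:E <= (expR (- t))%:E)%E.
  have -> : (\int[P]_omega (Q omega)%:E = \sum_o \int[P]_omega
      (mu o * (`|inner (rv_value xi omega) (Y o)| / lam) `^ p)%:E)%E.
    under eq_integral do rewrite -sumEFin.
    rewrite ge0_integral_sum //.
    - by move=> o; exact/measurable_EFinP.
    - by move=> o omega _; rewrite lee_fin mulr_ge0 ?powR_ge0.
  rewrite -[leRHS]mul1e -mu_sum -sumEFin ge0_sume_distrl; last first.
    by move=> o _; rewrite lee_fin.
  apply: lee_sum => o _.
  have -> : (\int[P]_omega (mu o * (`|inner (rv_value xi omega) (Y o)| / lam) `^ p)%:E =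
     (mu o * lam^-1 `^ p)%:E *
     \int[P]_omega (`|inner (rv_value xi omega) (Y o)| `^ p)%:E)%E.
    have E omega : mu o * (`|inner (rv_value xi omega) (Y o)| / lam) `^ p =
        mu o * lam^-1 `^ p * `|inner (rv_value xi omega) (Y o)| `^ p.
      by rewrite powRM ?invr_ge0 ?(ltW lam0) // mulrCA mulrC.
    under eq_integral do rewrite E EFinM.
    rewrite ge0_integralZl_EFin; first by [].
    - exact: measurableT.
    - by move=> omega _; rewrite lee_fin powR_ge0.
    - apply/measurable_EFinP.
      apply: (@measurableT_comp _ _ _ _ _ _ (fun x : R => x `^ p)).
        exact: measurable_powR.
      by apply: measurableT_comp => //; exact: measurable_inner_rv.
    - by rewrite mulr_ge0 ?powR_ge0.
  apply: le_trans (lee_wpmul2l _ (moment o)) _.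
    by rewrite lee_fin mulr_ge0 ?powR_ge0.
  rewrite -!EFinM lee_fin -mulrA ler_wpM2l // -powRM ?invr_ge0 ?(ltW lam0) ?(ltW a0) //.
  rewrite /lam invfM -mulrA mulVf ?gt_eqF // mulr1 -expRN -expRM.
  by rewrite mulNr divfK.
have mA : measurable [set omega | (Q omega <= 1)%R].
  rewrite -[X in measurable X]setTI.
  rewrite (_ : [set _ | _] = Q @^-1` [set` `]-oo, 1%R]%R]); last first.
    by apply/seteqP; split => omega /=; rewrite in_itv.
  by apply: mQ => //; exact: measurable_itv.
have PA : (P (~` [set omega | (Q omega <= 1)%R]) <= (expR (- t))%:E)%E.
  apply: le_trans intQ; rewrite -[X in (P X <= _)%E]setIT.
  rewrite -integral_indic //; last exact: measurableC.
  apply: ge0_le_integral.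
  - exact: measurableT.
  - by move=> omega _; rewrite lee_fin.
  - by apply/measurable_EFinP; apply: measurable_indic; exact: measurableC.
  - exact/measurable_EFinP.
  - move=> omega _; rewrite lee_fin indicE; have [Q1|Q1] := leP (Q omega) 1.
      by rewrite memNset // => /(_ Q1).
    by apply: le_trans (ltW Q1); rewrite lern1 leq_b1.
apply: (@le_trans _ _ (P [set omega | (Q omega <= 1)%R])).
  have := PA; rewrite probability_setC //.
  rewrite -(fineK (fin_num_measure P _ mA)) -EFinB !lee_fin; lra.
apply: le_measure; rewrite ?inE //; first exact: measurable_op_norm_le.
move=> omega /= Q1; apply: le_trans (smooth _ _ lam0) _; rewrite -/(Q omega).
have e0 : 0 < expR 4 :> R := expR_gt0 4.
have -> : tail_constant R * (expR (t / p) * H * D) = 3200 * lam * (1 + 2 * expR 4).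
  by rewrite /tail_constant /lam /a /K; field; rewrite gt_eqF.
apply: ler_wpM2l; last by rewrite lerD2r.
by apply: mulr_ge0; [exact: ler0n | exact: ltW].
Qed.

End random_matrix.

(** * Passage to the infimum over the exponent *)

Lemma probability_le_right (R : realType) (d : measure_display)
    (T : measurableType d) (P : probability T R) (X : T -> R) (b : R) (q : \bar R) :
  (forall r, measurable [set omega | X omega <= r]) ->
  (forall r, b < r -> (q <= P [set omega | (X omega <= r)%R])%E) ->
  (q <= P [set omega | (X omega <= b)%R])%E.
Proof.
(* Continuity from above along the decreasing events [F k], whose thresholds tend to [b]. *)
move=> mX qX; pose F k := [set omega | X omega <= b + k.+1%:R^-1].
have capF : [set omega | X omega <= b] = \bigcap_k F k.
  apply/seteqP; split => omega /=.
    by move=> Xb k _; rewrite /F /= (le_trans Xb) // lerDl invr_ge0.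
  move=> Xb; apply/ler_addgt0Pr => e e0.
  have [k ke] := @ltr_add_invr R 0 e e0; rewrite add0r in ke.
  by apply: le_trans (Xb k Logic.I) _; rewrite lerD2l ltW.
have cvF : P \o F @ \oo --> P (\bigcap_k F k).
  apply: nonincreasing_cvg_mu => //.
  - by rewrite (le_lt_trans (probability_le1 P (mX _))) ?ltry.
  - by move=> k; exact: mX.
  - by rewrite -capF; exact: mX.
  - move=> k l kl; apply/subsetPset => omega /= /le_trans; apply.
    by rewrite lerD2l lef_pV2 ?posrE ?ltr0n // ler_nat.
rewrite capF -(cvg_lim _ cvF) //.
apply: lime_ge; first by apply/cvg_ex; eexists; exact: cvF.
by apply: nearW => k; apply: qX; rewrite ltrDl invr_gt0.
Qed.

Theorem theorem5 (R : realType) :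
  exists c : R, 0 < c /\
  forall (d : measure_display) (T : measurableType d) (P : probability T R)
    (n d1 d2 : nat) (xi : random_vector P n) (h : R -> \bar R)
    (A : 'I_n -> 'M[R]_(d1, d2)),
    centered xi ->
    isotropic xi ->
    (forall p : R, 1 <= p -> (0 < h p)%E) ->
    moment_bound xi h ->
    forall t : R, 0 <= t ->
    ((1 - expR (- t))%:E <=
     P [set omega |
         (op_norm (lin_comb A (rv_value xi omega)))%:E <=
         c%:E * ereal_inf
           [set (expR (t / p))%:E * h p *
                (sigma_star A * Num.sqrt p + sigma A + upsilon A
                 + sigma_diamond A / Num.sqrt p)%:E
           | p in [set p : R | (2 <= p)%R]]])%E.
Proof.
exists (tail_constant R); split; first exact: tail_constant_gt0.
have c0 := tail_constant_gt0 R.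
move=> d T P n d1 d2 xi h A _ _ h0 mom t t0.
pose B (p : R) := sigma_star A * Num.sqrt p + sigma A + upsilon A
  + sigma_diamond A / Num.sqrt p.
have x0 p : 0 <= sigma_star A * Num.sqrt p by rewrite mulr_ge0 ?sigma_star_ge0 ?sqrtr_ge0.
have y0 := sigma_ge0 A.
have u0 := upsilon_ge0 A.
have z0 p : 0 <= sigma_diamond A / Num.sqrt p.
  by rewrite divr_ge0 ?sigma_diamond_ge0 ?sqrtr_ge0.
have B0 p : 0 <= B p by rewrite /B !addr_ge0.
set S := [set _ | p in _].
have S0 : (0 <= ereal_inf S)%E.
  apply: le_ereal_inf_tmp => _ [p /= p2 <-].
  by rewrite mule_ge0 ?lee_fin ?B0 // mule_ge0 ?lee_fin ?expR_ge0 // ltW // h0 //; lra.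
(* The infimum need not be attained, so the tail bound is proved at every real [r] above it, where
   some [p] has its bound below [r]. *)
have key r : (ereal_inf S < r%:E)%E ->
    ((1 - expR (- t))%:E <= P [set omega |
      (op_norm (lin_comb A (rv_value xi omega)) <= tail_constant R * r)%R])%E.
  move=> Sr; have r0 : 0 < r by rewrite -lte_fin; exact: le_lt_trans Sr.
  move: Sr => /ereal_inf_lt[_ [p /= p2 <-]]; rewrite -/(B p) => lt_r.
  have p1 : 1 <= p by lra.
  have e0 : 0 < expR (t / p) := expR_gt0 _.
  move: lt_r (h0 p p1) (fun v => mom v p p1); case: (h p) => [H| |] // lt_r H0 momp.
    rewrite lte_fin in H0; rewrite -!EFinM lte_fin in lt_r.
    have eH0 : 0 < expR (t / p) * H by exact: mulr_gt0.
    (* This quotient plays the role of [D]: unlike [B p], which may vanish, it is positive. *)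
    have D0 : 0 < r / (expR (t / p) * H) by exact: divr_gt0.
    have DB : B p <= r / (expR (t / p) * H).
      by rewrite ler_pdivlMr // mulrC ltW.
    rewrite (_ : r = expR (t / p) * H * (r / (expR (t / p) * H))); last first.
      by rewrite mulrC divfK // gt_eqF.
    apply: op_norm_tail => //; apply: le_trans DB.
    by rewrite /B; lra.
  (* Here [h p = +oo], and its product with [B p] stays below a real number only if [B p] is 0. The
     random matrix then has operator norm 0 everywhere. *)
  have Bp0 : B p = 0.
    apply/eqP; rewrite eq_le B0 andbT leNgt; apply/negP => Bp.
    by move: lt_r; rewrite gt0_muley ?lte_fin // gt0_mulye ?lte_fin.
  have s0 : sigma_star A = 0.
    have sp0 : 0 < Num.sqrt p by rewrite sqrtr_gt0; lra.
    have : sigma_star A * Num.sqrt p <= 0.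
      by move: Bp0; rewrite /B; have := z0 p; lra.
    rewrite pmulr_lle0 // => s0.
    by apply/eqP; rewrite eq_le s0 sigma_star_ge0.
  rewrite (_ : [set _ | _] = setT); last first.
    apply/seteqP; split => // omega _ /=.
    apply: le_trans (op_norm_lin_comb_sigma_star _ _) _.
    by rewrite s0 mulr0 mulr_ge0 // ltW.
  by rewrite probability_setT lee_fin gerBl expR_ge0.
case: (ereal_inf S) S0 key => [i| |] // S0 key.
- rewrite (_ : [set _ | _] = [set omega |
      (op_norm (lin_comb A (rv_value xi omega)) <= tail_constant R * i)%R]); last first.
    by apply/seteqP; split => omega /=; rewrite -EFinM lee_fin.
  apply: probability_le_right => [r|r]; first exact: measurable_op_norm_le.
  rewrite mulrC -ltr_pdivlMr // => ir.
  by rewrite -[r](@divfK _ (tail_constant R)) ?gt_eqF // mulrC; apply: key; rewrite lte_fin.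
(* An infinite infimum makes the event certain. *)
- rewrite (_ : [set _ | _] = setT).
    by rewrite probability_setT lee_fin gerBl expR_ge0.
  by apply/seteqP; split => // omega _ /=; rewrite gt0_muley ?lte_fin ?leey.
Qed.
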